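(* For every loopless signed graph $G$ with underlying unsigned graph $\underline{G}$ one has $\chi(G)\le 2\chi(\underline{G})-1$, where $\chi(G)$ is the chromatic number of the signed graph $G$ and $\chi(\underline{G})$ is the usual chromatic number of $\underline{G}$. Furthermore, this bound is sharp: for every integer $n\ge 1$ there exists a loopless signed graph $G$ with $\chi(\underline{G})=n$ and $\chi(G)=2n-1$.
   Context: All graphs are finite and nonempty. A signed graph $G$ is a graph (parallel edges allowed) in which each edge $e$ is labelled with a sign $\sigma(e)\in\{+1,-1\}$; its underlying unsigned graph, obtained by forgetting the signs, is denoted by $\underline{G}$. A proper colouring of $G$ is a mapping $\phi\colon V(G)\to\mathbb{Z}$ such that for each edge $e=uv$ of $G$ we have $\phi(u)\neq\sigma(e)\phi(v)$. For $n\ge1$ let $M_n=\{\pm1,\pm2,\ldots,\pm k\}$ if $n=2k$, and $M_n=\{0,\pm1,\pm2,\ldots,\pm k\}$ if $n=2k+1$. An $n$-colouring of $G$ is a proper colouring of $G$ using colours from $M_n$. The chromatic number $\chi(G)$ of a signed graph $G$ is the smallest $n\ge 1$ such that $G$ admits an $n$-colouring. *)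

(* Defs.v *)
From mathcomp Require Import all_boot all_order all_algebra.
From mathcomp Require Import boolp.
Set Implicit Arguments.
Unset Strict Implicit.
Unset Printing Implicit Defensive.
Import Order.TTheory GRing.Theory Num.Theory.

(* Finite nonempty multigraph: [ends e] is the unordered set of endpoints of    *)
(* [e], a singleton when [e] is a loop; parallel edges share the same [ends].   *)
Record graph := Graph {
  vertex : finType;
  edge : finType;
  ends : edge -> {set vertex};
  ends_card : forall e, 1 <= #|ends e| <= 2;
  vertex_nonempty : 0 < #|vertex| }.

Record signed_graph := SignedGraph {
  underlying : graph;
  sign : edge underlying -> int;
  signP : forall e, sign e = 1%R \/ sign e = (-1)%R }.

Definition loopless (G : graph) : Prop :=
  forall (e : edge G) (v : vertex G), ends e <> [set v].

(* The smallest natural number satisfying [P]; the junk value 0 is returned     *)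
(* when there is none (see [chromatic_exists], [signed_chromatic_exists]).      *)
Definition least (P : nat -> Prop) : nat :=
  if pselect (exists n, `[< P n >]) is left exP then ex_minn exP else 0.

Definition proper_colouring (G : graph) (C : Type) (phi : vertex G -> C) : Prop :=
  forall (e : edge G) (u v : vertex G), ends e = [set u; v] -> phi u <> phi v.

Definition colourable (G : graph) (n : nat) : Prop :=
  exists phi : vertex G -> 'I_n, proper_colouring phi.

Definition chromatic_number (G : graph) : nat := least (colourable G).

Definition signed_proper_colouring (G : signed_graph)
    (phi : vertex (underlying G) -> int) : Prop :=
  forall (e : edge (underlying G)) (u v : vertex (underlying G)),
    ends e = [set u; v] -> phi u <> (sign e * phi v)%R.

(* M_n: the integers c with 1 <= |c| <= k, k = n./2, together with 0 if n is odd. *)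
Definition signed_colours (n : nat) : pred int :=
  [pred c : int | (1 <= `|c|%N <= n./2) || (odd n && (c == 0%R))].

Definition signed_colourable (G : signed_graph) (n : nat) : Prop :=
  exists phi : vertex (underlying G) -> int,
    signed_proper_colouring phi /\ forall v, phi v \in signed_colours n.

Definition signed_chromatic_number (G : signed_graph) : nat :=
  least (fun n => 1 <= n /\ signed_colourable G n).

Lemma leastP (P : nat -> Prop) : (exists n, P n) ->
  P (least P) /\ forall n, P n -> least P <= n.
Proof.
move=> [n0 Pn0]; rewrite /least; case: pselect => [exP|[]]; last first.
  by exists n0; apply/asboolP.
case: ex_minnP => m /asboolP Pm min_m; split=> // n Pn.
by apply: min_m; apply/asboolP.
Qed.

Lemma chromatic_exists (G : graph) : loopless G -> exists n, colourable G n.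
Proof.
move=> loopG; exists #|vertex G|, enum_rank => e u v Ee /enum_rank_inj uv.
by apply: (loopG e v); rewrite Ee uv setUid.
Qed.

Lemma signed_chromatic_exists (G : signed_graph) : loopless (underlying G) ->
  exists n, 1 <= n /\ signed_colourable G n.
Proof.
move=> loopG; exists (#|vertex (underlying G)|).*2.+1; split=> //.
exists (fun v => Posz (enum_rank v).+1); split=> [e u v Ee|v].
  case: (signP e) => ->; rewrite ?mul1r ?mulN1r // => -[] /ord_inj.
  move=> /enum_rank_inj uv; apply: (loopG e v).
  by rewrite Ee uv setUid.
by rewrite inE /= uphalf_double ltn_ord.
Qed.

(* Main.v *)
(* A proper colouring by 0, ..., n-1 stays proper for any signs when its colours
   are read as integers, since distinct nonnegative integers are never opposite;
   these integers lie in M_(2n-1).  Equality holds for the complete graph on n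
   vertices with every edge doubled with both signs: its proper colourings have
   pairwise distinct absolute values, and M_m has only ceil(m/2) of these. *)
Require Import Defs.
From mathcomp Require Import all_boot all_order all_algebra.
From mathcomp Require Import zify.
Set Implicit Arguments.
Unset Strict Implicit.
Unset Printing Implicit Defensive.

Lemma least_eq (P : nat -> Prop) (n : nat) :
  P n -> (forall m, P m -> n <= m) -> least P = n.
Proof.
move=> Pn min_n; have [Pl lel] := leastP (ex_intro P n Pn).
by apply/eqP; rewrite eqn_leq lel // min_n.
Qed.

(** A graph has a vertex, and ['I_0] offers it no colour. This gives [1 <= 2 * n - 1], as the signed
    chromatic number requires. *)
Lemma colourable_gt0 (G : graph) (n : nat) : colourable G n -> 0 < n.
Proof.
case: n => // -[phi _]; have /card_gt0P[v _] := vertex_nonempty G.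
by case: (phi v).
Qed.

Lemma signed_colourable_of_colourable (G : signed_graph) (n : nat) :
  colourable (underlying G) n -> signed_colourable G (2 * n - 1).
Proof.
move=> [phi phiP]; exists (fun v => Posz (phi v)); split=> [e u v Ee|v].
  have /eqP := phiP e u v Ee; rewrite -val_eqE /=.
  by case: (signP e) => ->; lia.
(* As [2 * n - 1] is odd with half [n - 1], the colour 0 is allowed; [ltn_ord] also excludes
   [n = 0], where the subtraction truncates. *)
by rewrite inE; have := ltn_ord (phi v); lia.
Qed.

Lemma signed_chromatic_number_le (G : signed_graph) :
  loopless (underlying G) ->
  signed_chromatic_number G <= 2 * chromatic_number (underlying G) - 1.
Proof.
move=> loopG; have [colG _] := leastP (chromatic_exists loopG).
have [_] := leastP (signed_chromatic_exists loopG); apply.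
split; last exact: signed_colourable_of_colourable.
by have := colourable_gt0 colG; rewrite -/(chromatic_number _); lia.
Qed.

Lemma size_absz_signed_colours (m : nat) (s : seq int) :
  uniq (map absz s) -> {subset s <= signed_colours m} -> size s <= uphalf m.
Proof.
move=> uniq_s sM; rewrite -(size_map absz) -(size_iota (~~ odd m) (uphalf m)).
apply: uniq_leq_size => // _ /mapP[c /sM cM ->].
by move: cM; rewrite inE mem_iota; lia.
Qed.

(** The pairs are ordered, so two distinct vertices are joined by four parallel edges, two of each
    sign; the boolean selects the sign. *)
Definition double_edge (n : nat) : finType :=
  {e : 'I_n * 'I_n * bool | e.1.1 != e.1.2}.

Definition double_ends (n : nat) (e : double_edge n) : {set 'I_n} :=
  [set (val e).1.1; (val e).1.2].

Lemma card_double_ends (n : nat) (e : double_edge n) : #|double_ends e| = 2.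
Proof. by rewrite cards2 (valP e). Qed.

Lemma double_ends_bounds (n : nat) (e : double_edge n) :
  1 <= #|double_ends e| <= 2.
Proof. by rewrite card_double_ends. Qed.

Lemma card_ord_gt0 (n : nat) : 0 < n -> 0 < #|'I_n|.
Proof. by rewrite card_ord. Qed.

Definition double_complete (n : nat) (n_gt0 : 0 < n) : graph :=
  Graph (@double_ends_bounds n) (card_ord_gt0 n_gt0).

Definition double_sign (n : nat) (n_gt0 : 0 < n)
    (e : edge (double_complete n_gt0)) : int :=
  ((-1) ^+ (val e).2)%R.

Lemma double_signP (n : nat) (n_gt0 : 0 < n)
    (e : edge (double_complete n_gt0)) :
  double_sign e = 1%R \/ double_sign e = (-1)%R.
Proof. by rewrite /double_sign; case: (val e).2; [right | left]. Qed.

Definition signed_double_complete (n : nat) (n_gt0 : 0 < n) : signed_graph :=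
  SignedGraph (@double_signP n n_gt0).

Lemma double_complete_loopless (n : nat) (n_gt0 : 0 < n) :
  loopless (double_complete n_gt0).
Proof.
move=> e v Ee; have := @card_double_ends n e.
by rewrite -[double_ends e]/(ends e) Ee cards1.
Qed.

Lemma double_complete_colouring_inj (n : nat) (n_gt0 : 0 < n) (C : Type)
    (phi : vertex (double_complete n_gt0) -> C) :
  proper_colouring phi -> injective phi.
Proof.
move=> phiP u v phi_uv; case: (eqVneq u v) => // neq_uv.
pose e : double_edge n := exist _ (u, v, false) neq_uv.
by case: (phiP e u v).
Qed.

Lemma chromatic_double_complete (n : nat) (n_gt0 : 0 < n) :
  chromatic_number (double_complete n_gt0) = n.
Proof.
apply: least_eq => [|m [phi phiP]].
  exists id => e u v Ee uv; apply: (@double_complete_loopless n n_gt0 e v).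
  by rewrite Ee uv setUid.
have := leq_card _ (double_complete_colouring_inj phiP).
by rewrite !card_ord.
Qed.

(** Between distinct [u] and [v], a positive edge forbids equal colours and a negative edge forbids
    opposite ones. *)
Lemma signed_double_complete_absz_inj (n : nat) (n_gt0 : 0 < n)
    (phi : vertex (underlying (signed_double_complete n_gt0)) -> int) :
  signed_proper_colouring phi -> injective (absz \o phi).
Proof.
move=> phiP u v /= phi_uv; case: (eqVneq u v) => // neq_uv.
pose e b : double_edge n := exist _ (u, v, b) neq_uv.
have := phiP (e false) u v erefl; have := phiP (e true) u v erefl.
by rewrite /= /double_sign /= GRing.expr0 GRing.expr1; lia.
Qed.

Lemma signed_chromatic_double_complete (n : nat) (n_gt0 : 0 < n) :
  signed_chromatic_number (signed_double_complete n_gt0) = 2 * n - 1.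
Proof.
apply: least_eq => [|m [_ [phi [phiP phiM]]]].
  split; first by lia.
  apply: signed_colourable_of_colourable.
  (* Without loops the chromatic number is attained, so its value [n] yields an [n]-colouring. *)
  rewrite -[X in colourable _ X](chromatic_double_complete n_gt0).
  by case: (leastP (chromatic_exists (@double_complete_loopless n n_gt0))).
have: size (map phi (enum 'I_n)) <= uphalf m.
  apply: size_absz_signed_colours => [|_ /mapP[v _ ->]]; last exact: phiM.
  rewrite -map_comp map_inj_uniq ?enum_uniq //.
  exact: signed_double_complete_absz_inj.
(* The bound [n <= uphalf m] amounts to [2 * n - 1 <= m]. *)
by rewrite size_map size_enum_ord; lia.
Qed.

Theorem theorem2p1 :
  (forall G : signed_graph, loopless (underlying G) ->
     signed_chromatic_number G <= 2 * chromatic_number (underlying G) - 1) /\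
  (forall n : nat, 1 <= n ->
     exists G : signed_graph,
       [/\ loopless (underlying G),
           chromatic_number (underlying G) = n
         & signed_chromatic_number G = 2 * n - 1]).
Proof.
split=> [|n n_gt0]; first exact: signed_chromatic_number_le.
exists (signed_double_complete n_gt0); split.
- exact: double_complete_loopless.
- exact: chromatic_double_complete.
- exact: signed_chromatic_double_complete.
Qed.
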